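(* Let $n\ge2$ and let $C\subset\mathbb{R}^n$ be a Minkowski-centered convex body with $0$ in its interior. Then, with completeness and completions understood with respect to the diameter $D_{\mathrm{MAX}}(\cdot,C)$: (i) $C_{\mathrm{MAX}}$ is a completion of $C$, its circumradius is $R(C_{\mathrm{MAX}},C)=s(C)$, and this is maximal among the circumradii $R(K,C)$ of completions $K$ of $C$; (ii) $C_{\mathrm{MAX}}\subset C^{\sup}\subset C^{\mathrm{out}}$; (iii) $C_{\mathrm{MAX}}=C^{\sup}$ if and only if $C_{\mathrm{MAX}}=C^{\mathrm{out}}$; (iv) $C_{\mathrm{MAX}}$ is the unique $0$-symmetric completion of $C$.
   Context: A convex body is a nonempty compact convex set. $h_C(a)=\max_{x\in C}a^Tx$ is the support function; $C^\circ=\{a\in\mathbb{R}^n:h_C(a)\le1\}$ is the polar. The circumradius is $R(K,C)=\inf\{\rho\ge0:\exists t,\ K\subset t+\rho C\}$. The Minkowski asymmetry is $s(C)=R(C,-C)$, and $C$ is Minkowski-centered if $C\subset -s(C)C$. A set $X$ is $0$-symmetric if $X=-X$. $C_{\mathrm{MAX}}=\mathrm{conv}(C\cup(-C))$, and the maximum diameter of a convex body $K$ is $$D_{\mathrm{MAX}}(K,C)=\max_{u\in\mathbb{R}^n\setminus\{0\}}\frac{h_K(u)+h_K(-u)}{\max(h_C(u),h_C(-u))}.$$ A convex body $K$ is complete if $D_{\mathrm{MAX}}(K',C)>D_{\mathrm{MAX}}(K,C)$ for every convex body $K'\supsetneq K$. A completion of $K$ is a complete convex body $K^*\supset K$ with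 $D_{\mathrm{MAX}}(K^*,C)=D_{\mathrm{MAX}}(K,C)$. The supercompletion of $C$ is $C^{\sup}=\bigcap_{x\in C}\left(x+D_{\mathrm{MAX}}(C,C)\,C_{\mathrm{MAX}}\right)$. The outer symmetric support of $C$ is $C^{\mathrm{out}}=\bigcap_{a\in A}\{x\in\mathbb{R}^n:a^Tx\le1\}$ with $A=\mathrm{bd}(C^\circ)\cap\mathrm{bd}(-C^\circ)$. *)

(* Defs.v *)
From HB Require Import structures.
From mathcomp Require Import all_boot all_order all_algebra.
From mathcomp Require Import all_classical all_reals all_analysis.

Set Implicit Arguments.
Unset Strict Implicit.
Unset Printing Implicit Defensive.

Import Order.TTheory GRing.Theory Num.Theory.
Import numFieldNormedType.Exports.

Local Open Scope classical_set_scope.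
Local Open Scope ring_scope.

(* Points of R^n are row vectors 'rV[R]_n, whose library topology (that of the
   sup norm) is the Euclidean one.  Suprema and infima are the real-valued
   [sup] and [inf], which default to 0 on sets where they do not exist: they are
   only meaningful here for convex bodies, with 0 interior to the gauge C. *)

Section ConvexGeometry.
Context {R : realType} {n : nat}.
Implicit Types (A C K X : set 'rV[R]_n) (a u x t : 'rV[R]_n) (rho : R).

Definition dotp a x : R := (a *m x^T) 0 0.

Definition convex_body C : Prop := [/\ C !=set0, compact C & convex_set C].

Definition opp_set A : set 'rV[R]_n := [set - x | x in A].

Definition scale_set rho A : set 'rV[R]_n := [set rho *: x | x in A].

Definition translate t A : set 'rV[R]_n := [set t + x | x in A].

Definition symmetric0 X : Prop := X = opp_set X.

Definition boundary A : set 'rV[R]_n := closure A `\` A°.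

Definition convex_hull A : set 'rV[R]_n := smallest (@convex_set R 'rV[R]_n) A.

(* A maximum for nonempty compact C. *)
Definition supp C a : R := sup [set dotp a x | x in C].

Definition polar C : set 'rV[R]_n := [set a | supp C a <= 1].

Definition circumradius K C : R :=
  inf [set rho | 0 <= rho /\ exists t, K `<=` translate t (scale_set rho C)].

Definition asymmetry C : R := circumradius C (opp_set C).

Definition Minkowski_centered C : Prop := C `<=` scale_set (- asymmetry C) C.

Definition CMAX C : set 'rV[R]_n := convex_hull (C `|` opp_set C).

(* A maximum when K and C are convex bodies and 0 is interior to C: the quotient
   is continuous and 0-homogeneous in u. *)
Definition DMAX K C : R :=
  sup [set (supp K u + supp K (- u)) / Num.max (supp C u) (supp C (- u))
      | u in [set u : 'rV[R]_n | u != 0]].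

Definition complete_body C K : Prop :=
  convex_body K /\
  forall K', convex_body K' -> K `<` K' -> DMAX K C < DMAX K' C.

(* [completion C K Kstar]: Kstar is a completion of K, diameters being
   measured by DMAX with gauge C. *)
Definition completion C K Kstar : Prop :=
  [/\ complete_body C Kstar, K `<=` Kstar & DMAX Kstar C = DMAX K C].

Definition supercompletion C : set 'rV[R]_n :=
  \bigcap_(x in C) translate x (scale_set (DMAX C C) (CMAX C)).

Definition outer_symmetric_support C : set 'rV[R]_n :=
  \bigcap_(a in boundary (polar C) `&` boundary (opp_set (polar C)))
    [set x | dotp a x <= 1].

End ConvexGeometry.

(* Main.v *)
Require Import Defs.
From HB Require Import structures.
From mathcomp Require Import all_boot all_order all_algebra.
From mathcomp Require Import all_classical all_reals all_analysis.
From mathcomp Require Import ring lra.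

(** Write [h] for the support function of [C], [M] for [CMAX C],
[g(u) = max (h(u), h(-u))] for the support function of [M], and [s] for the
asymmetry of [C]. Everything is read off from inequalities between support
functions, because a convex body is determined by its support function
([convex_body_supp], by projection to the nearest point).

The quotient defining the diameter of [C] is at most [2], and equals [2] in a
direction with [h(u) = h(-u)]. Such a direction exists in dimension at least two
because the continuous odd function [h(u) - h(-u)] vanishes away from the origin
([odd_vanishes]). Hence [C] and [M] both have diameter [2]. A body containing
[M] with diameter [2] has support function at most [2 g(u) - g(-u) = g(u)], so
[M] is complete; a symmetric body of diameter [2] has support function at most
[g], so it lies in [M], and equals [M] if it is complete.

The supercompletion consists of the [y] with [u . y <= 2 g(u) - h(-u)] for
all [u] ([supercompletionP]). It therefore contains every completion of [C], and
centeredness gives [2 g(u) - h(-u) <= s h(u)], so all completions lie in [s C];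
for [M] this radius is optimal since [M] contains [- C]. When [h(a) = h(-a) = 1]
the inequality for [a] reads [a . y <= 1], which gives the inclusion in the
outer symmetric support.

The substantial step is that [M] equal to its supercompletion implies [M] equal
to the outer symmetric support ([outer_sub_CMAX]). Let [y] be outside [M] and
[z] the last point of [M] on the ray from [0] to [y]. The inequality defining
the supercompletion is weaker than [u . y <= g(u)] exactly when [h(u) > h(-u)].
If no functional with [h(u) <= h(-u)] supported [M] at [z], all the inequalities
of the supercompletion would be strict at [z], and by compactness a larger
multiple of [z] would lie in it, hence in [M]. The same holds at [- z]. So [M]
is supported at [z] by functionals of both types, and by continuity by one
between them with [h(a) = h(-a)], normalized to [1]. Then [a . z >= 1], so
[a . y > 1] and [y] is not in the outer symmetric support. *)

Set Implicit Arguments.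
Unset Strict Implicit.
Unset Printing Implicit Defensive.

Import Order.TTheory GRing.Theory Num.Theory.
Import numFieldNormedType.Exports.

Local Open Scope classical_set_scope.
Local Open Scope ring_scope.

(** * The scalar product *)

Section ScalarProduct.
Context {R : realType} {n : nat}.
Implicit Types (a u v x y : 'rV[R]_n) (c : R).

Lemma dotpE a x : dotp a x = \sum_i a 0 i * x 0 i.
Proof. by rewrite /dotp mxE; apply: eq_bigr => i _; rewrite mxE. Qed.

Lemma dotpC a x : dotp a x = dotp x a.
Proof. by rewrite !dotpE; apply: eq_bigr => i _; rewrite mulrC. Qed.

Lemma dotpDl u v x : dotp (u + v) x = dotp u x + dotp v x.
Proof. by rewrite /dotp mulmxDl mxE. Qed.

Lemma dotpDr u x y : dotp u (x + y) = dotp u x + dotp u y.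
Proof. by rewrite dotpC dotpDl !(dotpC u). Qed.

Lemma dotpNl u x : dotp (- u) x = - dotp u x.
Proof. by rewrite /dotp mulNmx mxE. Qed.

Lemma dotpNr u x : dotp u (- x) = - dotp u x.
Proof. by rewrite dotpC dotpNl dotpC. Qed.

Lemma dotpZl c u x : dotp (c *: u) x = c * dotp u x.
Proof. by rewrite /dotp -scalemxAl mxE. Qed.

Lemma dotpZr c u x : dotp u (c *: x) = c * dotp u x.
Proof. by rewrite dotpC dotpZl dotpC. Qed.

Lemma dotp0l x : dotp 0 x = 0.
Proof. by rewrite /dotp mul0mx mxE. Qed.

Lemma dotp0r u : dotp u 0 = 0.
Proof. by rewrite dotpC dotp0l. Qed.

Lemma dotp_sqrD c u v : dotp (u + c *: v) (u + c *: v) =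
  dotp u u + 2 * (c * dotp u v) + c * (c * dotp v v).
Proof. by rewrite dotpDl !dotpDr !dotpZl !dotpZr (dotpC v u); ring. Qed.

Lemma const_mx1_neq0 : (0 < n)%N -> const_mx 1 != 0 :> 'rV[R]_n.
Proof.
by move=> n0; apply/eqP => /rowP /(_ (Ordinal n0)) /eqP; rewrite !mxE oner_eq0.
Qed.

Lemma dotp_eq0 u : (dotp u u == 0) = (u == 0).
Proof.
apply/eqP/eqP => [|->]; last exact: dotp0l.
rewrite dotpE => /eqP; rewrite psumr_eq0 => [/allP u0|i _]; last first.
  exact: sqr_ge0.
apply/rowP => i; rewrite mxE; apply/eqP.
by have := u0 i (mem_index_enum _); rewrite mulf_eq0 orbb.
Qed.

Lemma dotp_gt0 u : u != 0 -> 0 < dotp u u.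
Proof.
rewrite -dotp_eq0 lt_neqAle eq_sym => -> /=.
by rewrite dotpE sumr_ge0 // => i _; exact: sqr_ge0.
Qed.

Lemma ler_coord_norm x i : `|x 0 i| <= `|x|.
Proof.
rewrite [leRHS]/Num.Def.normr /= mx_normrE.
exact: (le_bigmax _ (fun ij : 'I_1 * 'I_n => `|x ij.1 ij.2|) (0, i)).
Qed.

Lemma ler_norm_dotp u x : `|dotp u x| <= n%:R * `|u| * `|x|.
Proof.
rewrite dotpE (le_trans (ler_norm_sum _ _ _)) //.
rewrite -mulrA mulr_natl -[X in _ *+ X](card_ord n) -sumr_const.
by apply: ler_sum => i _; rewrite normrM ler_pM // ler_coord_norm.
Qed.

Lemma continuous_coord (T : topologicalType) (f : T -> 'rV[R]_n) i :
  continuous f -> continuous (fun z => f z 0 i).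
Proof.
move=> cf z.
exact: (cvg_comp _ _ (cf z) (@coord_continuous _ _ _ 0 i (f z))).
Qed.

Lemma continuous_dotp (T : topologicalType) (f g : T -> 'rV[R]_n) :
  continuous f -> continuous g -> continuous (fun z => dotp (f z) (g z)).
Proof.
move=> cf cg; rewrite (_ : (fun z => _) = fun z => \sum_i f z 0 i * g z 0 i).
  apply: (continuous_big (@add_continuous R)) => i _ z.
  by apply: cvgM; exact: continuous_coord.
by apply/funext => z; rewrite dotpE.
Qed.

Lemma continuous_dotpr u : continuous (dotp u).
Proof.
apply: (@continuous_dotp _ (fun=> u) id) => z; last exact: cvg_id.
exact: cst_continuous.
Qed.

End ScalarProduct.

(** * Convex combinations *)

Section ConvexSets.
Context {R : realType} {n : nat}.
Implicit Types (A : set 'rV[R]_n) (x y : 'rV[R]_n) (c t : R).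

Lemma convex_setP A : convex_set A <->
  forall x y (t : R), 0 <= t <= 1 -> A x -> A y -> A (t *: x + (1 - t) *: y).
Proof.
split=> [cA x y t /andP[t0 t1] Ax Ay|cA x y t].
  by have := cA x y (Itv01 t0 t1); rewrite !inE; apply.
rewrite !inE => Ax Ay; apply: (cA) => //.
by rewrite ge0 le1.
Qed.

Lemma convex_set_comb A c t x y :
  convex_set A -> 0 <= c -> 0 <= t -> A x -> A y ->
  exists2 z, A z & c *: x + t *: y = (c + t) *: z.
Proof.
move=> /convex_setP vA c0 t0 Ax Ay; have [ct0|ct0] := eqVneq (c + t) 0.
  exists x => //; move/eqP: ct0; rewrite paddr_eq0 // => /andP[/eqP -> /eqP ->].
  by rewrite addr0 !scale0r addr0.
have ct_gt0 : 0 < c + t by rewrite lt_neqAle eq_sym ct0 addr_ge0.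
exists ((c / (c + t)) *: x + (1 - c / (c + t)) *: y).
  apply: vA => //; rewrite divr_ge0 ?addr_ge0 //=.
  by rewrite ler_pdivrMr // mul1r lerDl.
by apply/rowP => i; rewrite !mxE; field.
Qed.

End ConvexSets.
(** * Support functions *)

Section SupportFunction.
Context {R : realType} {n : nat}.
Implicit Types (K L : set 'rV[R]_n) (u v x y p : 'rV[R]_n) (c : R).

Lemma supp_ubound K u x : compact K -> K x -> dotp u x <= supp K u.
Proof.
move=> cK Kx; apply: sup_upper_bound; last by exists x.
apply: compact_has_sup; first by exists (dotp u x), x.
apply: continuous_compact cK.
exact/continuous_subspaceT/continuous_dotpr.
Qed.

Lemma supp_le K u c :
  K !=set0 -> (forall x, K x -> dotp u x <= c) -> supp K u <= c.
Proof.
move=> [x Kx] Kc; apply: ge_sup; first by exists (dotp u x), x.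
by move=> _ [y Ky <-]; exact: Kc.
Qed.

Lemma suppS K L u : K !=set0 -> compact L -> K `<=` L -> supp K u <= supp L u.
Proof. by move=> K0 cL KL; apply: supp_le => // x /KL; exact: supp_ubound. Qed.

Lemma suppD K u v : K !=set0 -> compact K ->
  supp K (u + v) <= supp K u + supp K v.
Proof.
move=> K0 cK; apply: supp_le => // x Kx.
by rewrite dotpDl lerD // supp_ubound.
Qed.

Lemma suppZ K c u : K !=set0 -> compact K -> 0 <= c ->
  supp K (c *: u) = c * supp K u.
Proof.
move=> K0 cK; rewrite le_eqVlt => /predU1P[<-|c0].
  rewrite scale0r mul0r; case: K0 => x Kx; apply/eqP; rewrite eq_le.
  rewrite -{2}(dotp0l x) supp_ubound // andbT.
  by apply: supp_le => [|y _]; [exists x|rewrite dotp0l].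
apply/eqP; rewrite eq_le; apply/andP; split.
  by apply: supp_le => // x Kx; rewrite dotpZl ler_pM2l // supp_ubound.
rewrite mulrC -ler_pdivlMr //; apply: supp_le => // x Kx.
by rewrite ler_pdivlMr // mulrC -dotpZl supp_ubound.
Qed.

(** A support function is subadditive and at most linear in the norm, hence
Lipschitz. *)
Lemma continuous_supp K : K !=set0 -> compact K -> continuous (supp K).
Proof.
move=> K0 cK.
have [M [_ KM]] := compact_bounded cK.
pose k : R := n%:R * (`|M| + 1) + 1.
have k0 : 0 < k by rewrite ltr_wpDl // mulr_ge0 // addr_ge0.
have suppk w : supp K w <= k * `|w|.
  apply: supp_le => // x Kx; apply: le_trans (ler_norm _) _.
  apply: le_trans (ler_norm_dotp _ _) _; rewrite mulrAC ler_wpM2r //.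
  apply: le_trans (_ : n%:R * (`|M| + 1) <= _); last by rewrite lerDl.
  by rewrite ler_wpM2l // KM // (le_lt_trans (ler_norm M)) // ltrDl.
have suppB u v : supp K u - supp K v <= k * `|u - v|.
  rewrite lerBlDl (le_trans _ (lerD (lexx _) (suppk _))) //.
  by rewrite -{1}(subrKC v u) suppD.
move=> u; apply/(@cvgrPdist_le _ _ _ (nbhs u) (nbhs_filter u)) => e e0.
have ek : 0 < e / k by exact: divr_gt0.
apply: filterS (nbhsx_ballx u _ ek) => v; rewrite -ball_normE /= => /ltW uv.
have kuv : k * `|u - v| <= e by rewrite mulrC -ler_pdivlMr.
rewrite ler_norml lerNl opprB (le_trans (suppB u v) kuv) andbT.
by rewrite (le_trans (suppB v u)) // distrC.
Qed.

(** A point outside [K] is separated from [K] by the direction pointing to it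
from its nearest point in [K]. *)
Lemma convex_body_supp K p :
  convex_body K -> (forall u, dotp u p <= supp K u) -> K p.
Proof.
move=> [K0 cK /convex_setP vK] Kp.
have cB : continuous (fun x : 'rV[R]_n => x - p).
  move=> x; apply: (@continuousB _ _ _ id (cst p)); first exact: cvg_id.
  exact: cst_continuous.
have [q] := compact_EVT_min K0 cK
  (continuous_subspaceT (continuous_dotp cB cB)).
rewrite inE => Kq qmin.
(* First variation of the squared distance to [p] along the segment [q, x];
[t] below minimizes the quadratic [2 t b + t^2 d] on the unit interval. *)
have obtuse x : K x -> 0 <= dotp (q - p) (x - q).
  move=> Kx; rewrite leNgt; apply/negP => lt0.
  set b := dotp (q - p) (x - q) in lt0.
  pose d := dotp (x - q) (x - q).
  have xq : x - q != 0.
    by apply: contraTneq lt0 => xq; rewrite /b xq dotp0r ltxx.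
  have d0 : 0 < d by exact: dotp_gt0.
  pose t := Num.min 1 (- b / d).
  have t0 : 0 < t by rewrite /t lt_min ltr01 divr_gt0 // oppr_gt0.
  have t1 : t <= 1 by rewrite /t ge_min lexx.
  have tb : t * d <= - b by rewrite -ler_pdivlMr // /t ge_min lexx orbT.
  have /qmin : t *: x + (1 - t) *: q \in K.
    by rewrite inE; apply: vK => //; rewrite ltW.
  have -> : t *: x + (1 - t) *: q - p = (q - p) + t *: (x - q).
    by apply/rowP => i; rewrite !mxE; ring.
  rewrite dotp_sqrD -/b -/d => h.
  have tb2 : t * (t * d) <= t * - b by rewrite ler_pM2l.
  have : 0 < t * - b by rewrite mulr_gt0 // oppr_gt0.
  move: h tb2; lra.
suff /eqP : dotp (p - q) (p - q) = 0.
  by rewrite dotp_eq0 subr_eq0 => /eqP ->.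
apply/eqP; rewrite eq_le; apply/andP; split; last first.
  by have [->|/dotp_gt0/ltW //] := eqVneq (p - q) 0; rewrite dotp0r.
rewrite dotpDr dotpNr subr_le0 (le_trans (Kp _)) //.
apply: supp_le => // x /obtuse; rewrite -[q - p]opprB dotpNl oppr_ge0.
by rewrite dotpDr dotpNr subr_le0.
Qed.

Lemma convex_body_sub_supp K L : K !=set0 -> compact K -> convex_body L ->
  (forall u, supp K u <= supp L u) -> K `<=` L.
Proof.
move=> K0 cK bL KL x Kx; apply: convex_body_supp => // u.
exact: le_trans (supp_ubound _ cK Kx) (KL u).
Qed.

End SupportFunction.
(** * The symmetrized gauge *)

Section Symmetrization.
Context {R : realType} {n : nat}.
Implicit Types (A C K : set 'rV[R]_n) (u x y z : 'rV[R]_n) (c t : R).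

Lemma convex_hull_convex A : convex_set (convex_hull A).
Proof.
apply/convex_setP => x y t t01 hx hy B [vB AB].
by have /convex_setP := vB; apply => //; [exact: hx|exact: hy].
Qed.

(** The set of these combinations is already convex because [C] is, so the hull
needs no combination of more than two points. This makes [CMAX C] a continuous
image of [C * C * [0, 1]], hence compact. *)
Lemma CMAXP C z : convex_set C -> CMAX C z <->
  exists x y t, [/\ 0 <= t <= 1, C x, C y & z = t *: x - (1 - t) *: y].
Proof.
move=> vC; split; last first.
  move=> [x [y [t [t01 Cx Cy ->]]]]; rewrite -scalerN.
  have /convex_setP := @convex_hull_convex (C `|` opp_set C); apply => //.
    by apply: sub_gen_smallest; left.
  by apply: sub_gen_smallest; right; exists y.
pose S := [set z | exists x y t,
  [/\ 0 <= t <= 1, C x, C y & z = t *: x - (1 - t) *: y]].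
apply: (@smallest_sub _ _ _ S); last first.
  move=> x [Cx|[y Cy <-]].
    exists x, x, 1; split; rewrite ?lexx ?ler01 //.
    by rewrite scale1r subrr scale0r subr0.
  by exists y, y, 0; split; rewrite ?lexx ?ler01 // subr0 scale0r add0r scale1r.
apply/convex_setP => z1 z2 l /andP[l0 l1].
move=> [x [y [t [/andP[t0 t1] Cx Cy ->]]]].
move=> [x' [y' [t' [/andP[t'0 t'1] Cx' Cy' ->]]]].
have [l1' t1' t'1'] : [/\ 0 <= 1 - l, 0 <= 1 - t & 0 <= 1 - t'] by split; lra.
have [X CX eX] := @convex_set_comb _ _ C (l * t) ((1 - l) * t') x x' vC
  (mulr_ge0 l0 t0) (mulr_ge0 l1' t'0) Cx Cx'.
have [Y CY eY] := @convex_set_comb _ _ C (l * (1 - t)) ((1 - l) * (1 - t'))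
  y y' vC (mulr_ge0 l0 t1') (mulr_ge0 l1' t'1') Cy Cy'.
exists X, Y, (l * t + (1 - l) * t'); split => //.
  rewrite addr_ge0 ?mulr_ge0 //=.
  have : 0 <= l * (1 - t) + (1 - l) * (1 - t') by rewrite addr_ge0 ?mulr_ge0.
  lra.
rewrite -eX.
have -> : 1 - (l * t + (1 - l) * t') = l * (1 - t) + (1 - l) * (1 - t') by ring.
by rewrite -eY; apply/rowP => i; rewrite !mxE; ring.
Qed.

Lemma sub_CMAX C : C `<=` CMAX C.
Proof. by move=> x Cx; apply: sub_gen_smallest; left. Qed.

Lemma opp_sub_CMAX C x : C x -> CMAX C (- x).
Proof. by move=> Cx; apply: sub_gen_smallest; right; exists x. Qed.

Lemma CMAX_opp C x : convex_set C -> CMAX C x -> CMAX C (- x).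
Proof.
move=> vC /(CMAXP _ vC)[y [z [t [t01 Cy Cz ->]]]]; apply/(CMAXP _ vC).
exists z, y, (1 - t); split => //; first by move: t01; lra.
by apply/rowP => i; rewrite !mxE; ring.
Qed.

Lemma symmetric0_CMAX C : convex_set C -> symmetric0 (CMAX C).
Proof.
move=> vC; apply/seteqP; split=> [x Mx|_ [x Mx <-]]; last exact: CMAX_opp.
by exists (- x); [exact: CMAX_opp|rewrite opprK].
Qed.

Lemma convex_body_CMAX C : convex_body C -> convex_body (CMAX C).
Proof.
move=> [[x Cx] cC vC]; split; [|  |exact: convex_hull_convex].
  by exists x; exact: sub_CMAX.
pose f (p : ('rV[R]_n * 'rV[R]_n) * R) := p.2 *: p.1.1 - (1 - p.2) *: p.1.2.
have -> : CMAX C = f @` ((C `*` C) `*` `[0, 1]).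
  apply/seteqP; split=> [z /(CMAXP _ vC)[y [y' [t [t01 Cy Cy' ->]]]]|z].
    by exists ((y, y'), t).
  move=> [[[y y'] t] /= [[Cy Cy'] t01] <-]; apply/(CMAXP _ vC).
  by exists y, y', t; rewrite in_itv/= in t01.
apply: continuous_compact; last first.
  by do 2?apply: compact_setX => //; exact: segment_compact.
apply: continuous_subspaceT => p.
have c2 : {for p, continuous (fun p : ('rV[R]_n * 'rV[R]_n) * R => p.2)}.
  exact: cvg_snd.
have c1 : {for p, continuous (fun p : ('rV[R]_n * 'rV[R]_n) * R => p.1)}.
  exact: cvg_fst.
apply: cvgB; apply: cvgZ => //.
- by apply: (cvg_comp _ _ c1); exact: cvg_fst.
- by apply: cvgB => //; exact: cvg_cst.
- by apply: (cvg_comp _ _ c1); exact: cvg_snd.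
Qed.

Lemma supp_CMAX C u : convex_body C ->
  supp (CMAX C) u = Num.max (supp C u) (supp C (- u)).
Proof.
move=> bC; have [M0 cM _] := convex_body_CMAX bC; have [C0 cC vC] := bC.
apply/eqP; rewrite eq_le ge_max; apply/and3P; split.
- apply: supp_le => // z /(CMAXP _ vC)[x [y [t [/andP[t0 t1] Cx Cy ->]]]].
  rewrite dotpDr -scaleNr !dotpZr.
  have hx : dotp u x <= Num.max (supp C u) (supp C (- u)).
    by rewrite le_max supp_ubound.
  have hy : - dotp u y <= Num.max (supp C u) (supp C (- u)).
    by rewrite le_max -dotpNl supp_ubound ?orbT.
  set m := Num.max _ _ in hx hy *.
  have := ler_wpM2l t0 hx.
  have : (1 - t) * - dotp u y <= (1 - t) * m by rewrite ler_wpM2l // subr_ge0.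
  lra.
- by apply: suppS => //; exact: sub_CMAX.
- apply: supp_le => // x Cx; rewrite dotpNl -dotpNr supp_ubound //.
  exact: opp_sub_CMAX.
Qed.

Lemma supp_CMAXN C u : convex_body C -> supp (CMAX C) (- u) = supp (CMAX C) u.
Proof. by move=> bC; rewrite !supp_CMAX // opprK maxC. Qed.

End Symmetrization.
(** * Gauges with the origin in their interior *)

Section Gauge.
Context {R : realType} {n : nat}.
Implicit Types (C K : set 'rV[R]_n) (u v w x y z : 'rV[R]_n) (c t : R).

Lemma interior_absorbs C x : C° 0 -> exists2 e : R, 0 < e & C (e *: x).
Proof.
move=> /nbhs_ballP[r /= r0 rC]; have k0 : 0 < `|x| + 1 by rewrite ltr_wpDl.
exists (r / (`|x| + 1)); first by rewrite divr_gt0.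
apply: rC; rewrite -ball_normE /= sub0r normrN normrZ gtr0_norm ?divr_gt0 //.
by rewrite mulrAC ltr_pdivrMr // ltr_pM2l // ltrDl.
Qed.

Lemma interior_absorbs_compact C K : C° 0 -> compact K ->
  exists2 c : R, 0 < c & forall x, K x -> C (c *: x).
Proof.
move=> /nbhs_ballP[r /= r0 rC] /compact_bounded[M [_ KM]].
have k0 : 0 < `|M| + 2 by rewrite ltr_wpDl.
exists (r / (`|M| + 2)) => [|x Kx]; first by rewrite divr_gt0.
apply: rC; rewrite -ball_normE /= sub0r normrN normrZ gtr0_norm ?divr_gt0 //.
rewrite mulrAC ltr_pdivrMr // ltr_pM2l //.
apply: le_lt_trans (KM (`|M| + 1) _ x Kx) _; last by rewrite ltrD2l ltr1n.
by rewrite (le_lt_trans (ler_norm M)) // ltrDl.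
Qed.

Lemma supp_gt0 C u : compact C -> C° 0 -> u != 0 -> 0 < supp C u.
Proof.
move=> cC /interior_absorbs -/(_ u)[e e0 Ce] u0.
by apply: lt_le_trans (supp_ubound u cC Ce); rewrite dotpZr mulr_gt0 ?dotp_gt0.
Qed.

Lemma supp_CMAX_gt0 C u : convex_body C -> C° 0 -> u != 0 ->
  0 < supp (CMAX C) u.
Proof.
by move=> bC h0 u0; rewrite supp_CMAX // lt_max supp_gt0 //; case: bC.
Qed.

Lemma supp0 K : K !=set0 -> compact K -> supp K 0 = 0.
Proof. by move=> K0 cK; rewrite -(scale0r 0) suppZ // mul0r. Qed.

(** [DMAX] is a real supremum, which is an upper bound only once the quotients
are bounded: [K] lies in a multiple of [C]. *)
Lemma width_DMAX C K u : convex_body C -> C° 0 -> K !=set0 -> compact K ->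
  supp K u + supp K (- u) <= DMAX K C * supp (CMAX C) u.
Proof.
move=> bC h0 K0 cK; have [C0 cC _] := bC.
have [M0 cM _] := convex_body_CMAX bC.
have [->|u0] := eqVneq u 0; first by rewrite oppr0 !supp0 // addr0 mulr0.
rewrite -ler_pdivrMr ?supp_CMAX_gt0 //; apply: ub_le_sup; last first.
  by exists u; rewrite // supp_CMAX.
have [c c0 Kc] := interior_absorbs_compact h0 cK.
have suppK v : supp K v <= c^-1 * supp (CMAX C) v.
  apply: supp_le => // x /Kc Cx; rewrite ler_pdivlMl // -dotpZr.
  by rewrite supp_ubound //; exact: sub_CMAX.
exists (2 * c^-1) => _ [v /= v0 <-]; rewrite -supp_CMAX //.
rewrite ler_pdivrMr ?supp_CMAX_gt0 //.
have := suppK (- v); rewrite supp_CMAXN //; have := suppK v; lra.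
Qed.

Lemma DMAX_le C K c : (0 < n)%N -> convex_body C -> C° 0 ->
  (forall u, supp K u + supp K (- u) <= c * supp (CMAX C) u) -> DMAX K C <= c.
Proof.
move=> n0 bC h0 Kc; apply: ge_sup => [|_ [u /= u0 <-]].
  pose u : 'rV[R]_n := const_mx 1.
  exists ((supp K u + supp K (- u)) / Num.max (supp C u) (supp C (- u))).
  exists u => //=.
  exact: const_mx1_neq0.
by rewrite -supp_CMAX // ler_pdivrMr ?supp_CMAX_gt0.
Qed.

Lemma DMAX_CMAX C : (0 < n)%N -> convex_body C -> C° 0 -> DMAX (CMAX C) C = 2.
Proof.
move=> n0 bC h0; have [M0 cM _] := convex_body_CMAX bC.
apply/eqP; rewrite eq_le; apply/andP; split.
  by apply: DMAX_le => // u; rewrite supp_CMAXN // mulr_natl mulr2n.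
pose u : 'rV[R]_n := const_mx 1.
have u0 : u != 0 by exact: const_mx1_neq0.
rewrite -(ler_pM2r (supp_CMAX_gt0 bC h0 u0)) mulr_natl mulr2n.
by rewrite -{2}(supp_CMAXN u bC) width_DMAX.
Qed.

(** The curve [t |-> t e0 + (1 - t^2) e1] joins two antipodal points and avoids
the origin, so the intermediate value theorem applies along it. *)
Lemma odd_vanishes (f : 'rV[R]_n -> R) : (2 <= n)%N -> continuous f ->
  (forall u, f (- u) = - f u) -> exists2 u, u != 0 & f u = 0.
Proof.
move=> n2 cf oddf.
pose i : 'I_n := Ordinal (ltnW n2); pose j : 'I_n := Ordinal n2.
pose p (t : R) : 'rV[R]_n := t *: delta_mx 0 i + (1 - t * t) *: delta_mx 0 j.
have pN : p (-1) = - p 1.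
  by rewrite /p mulrNN mulr1 subrr !scale0r !addr0 scaleNr.
have cp : continuous (f \o p).
  move=> t; apply: continuous_comp; last exact: cf.
  apply: cvgD; apply: cvgZr_tmp; first exact: cvg_id.
  by apply: cvgB; [exact: cvg_cst|apply: cvgM; exact: cvg_id].
have [|||t _ ft] := @IVT R (f \o p) (-1) 1 0.
- lra.
- exact: continuous_subspaceT.
- rewrite /= pN oddf ge_min le_max oppr_le0 oppr_ge0.
  by case/orP: (le_total 0 (f (p 1))) => ->; rewrite ?orbT.
exists (p t) => //; apply/eqP => /rowP pt0.
have /eqP := pt0 i; rewrite !mxE /= mulr0 addr0 mulr1 => /eqP t0.
have /eqP := pt0 j; rewrite !mxE /= t0 !mulr0 add0r subr0 mulr1.
by rewrite oner_eq0.
Qed.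

Lemma continuous_skew C : convex_body C ->
  continuous (fun u => supp C u - supp C (- u)).
Proof.
move=> [C0 cC _] u; have cs := continuous_supp C0 cC.
apply: (@continuousB _ R^o _ (supp C) (supp C \o -%R)); first exact: cs.
by apply: continuous_comp; [exact: opp_continuous|exact: cs].
Qed.

(** The quotient is at most [2] everywhere, with equality in the directions [u]
where [h(u) = h(-u)], [h] being the support function of [C]. *)
Lemma DMAX_self C : (2 <= n)%N -> convex_body C -> C° 0 -> DMAX C C = 2.
Proof.
move=> n2 bC h0; have [C0 cC _] := bC.
apply/eqP; rewrite eq_le; apply/andP; split.
  apply: DMAX_le => //; first exact: ltnW.
  move=> u; rewrite supp_CMAX // mulr_natl mulr2n.
  by rewrite lerD // le_max lexx ?orbT.
have [|u u0 hu] := odd_vanishes n2 (continuous_skew bC).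
  by move=> u; rewrite opprK opprB.
rewrite -(ler_pM2r (supp_CMAX_gt0 bC h0 u0)) mulr_natl mulr2n.
apply: le_trans (width_DMAX u bC h0 C0 cC); rewrite supp_CMAX //.
by move/eqP: hu; rewrite subr_eq0 => /eqP <-; rewrite maxxx.
Qed.

End Gauge.
(** * Circumradius and asymmetry *)

Section Circumradius.
Context {R : realType} {n : nat}.
Implicit Types (C K : set 'rV[R]_n) (u v x y t : 'rV[R]_n) (rho : R).

Lemma circumradius_le K C rho t : 0 <= rho ->
  K `<=` translate t (scale_set rho C) -> circumradius K C <= rho.
Proof.
by move=> rho0 KC; apply: ge_inf; [exists 0 => r []|split => //; exists t].
Qed.

Lemma circumradius_ge0 K C : 0 <= circumradius K C.
Proof.
rewrite /circumradius; set E := [set rho | _].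
have [E0|/set0P/negP/negPn/eqP ->] := pselect (E !=set0); last by rewrite inf0.
by apply: lb_le_inf => // r [].
Qed.

Lemma supp_Minkowski C u : convex_body C -> Minkowski_centered C ->
  supp C u <= asymmetry C * supp C (- u).
Proof.
move=> [C0 cC _] mC; apply: supp_le => // x /mC[y Cy <-].
rewrite scaleNr -scalerN dotpZr dotpNr -dotpNl ler_wpM2l ?circumradius_ge0 //.
exact: supp_ubound.
Qed.

(** The inclusion [C `<=` - s C] makes the width of [C] in any direction at most
[s] times itself. *)
Lemma asymmetry_ge1 C : (0 < n)%N -> convex_body C -> C° 0 ->
  Minkowski_centered C -> 1 <= asymmetry C.
Proof.
move=> n0 bC h0 mC; have [_ cC _] := bC.
pose u : 'rV[R]_n := const_mx 1.
have u0 : u != 0 by exact: const_mx1_neq0.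
have hu : 0 < supp C u + supp C (- u) by rewrite addr_gt0 ?supp_gt0 ?oppr_eq0.
rewrite -(ler_pM2r hu).
have := supp_Minkowski u bC mC; have := supp_Minkowski (- u) bC mC.
rewrite opprK; lra.
Qed.

(** [CMAX C] contains [- C], so a homothet of [C] containing it contains [- C];
negate this inclusion. *)
Lemma asymmetry_le_circumradius_CMAX C rho t : 0 <= rho ->
  CMAX C `<=` translate t (scale_set rho C) -> asymmetry C <= rho.
Proof.
move=> rho0 MC; apply: (@circumradius_le _ _ _ (- t)) => // x Cx.
have [_ [y Cy <-] xE] := MC _ (opp_sub_CMAX Cx).
exists (rho *: - y); first by exists (- y) => //; exists y.
by rewrite scalerN -opprD xE opprK.
Qed.

End Circumradius.

(** * The supercompletion and the outer symmetric support *)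

Section Supercompletion.
Context {R : realType} {n : nat}.
Implicit Types (C K : set 'rV[R]_n) (a u v w x y z : 'rV[R]_n).

(** Separation describes each translate [x + 2 CMAX C] by the inequalities
[u . y <= u . x + 2 g(u)], with [g] the support function of [CMAX C]; the
infimum of [u . x] over [x] in [C] is minus the support function of [C] at
[- u]. *)
Lemma supercompletionP C y : (2 <= n)%N -> convex_body C -> C° 0 ->
  supercompletion C y <->
  forall u, dotp u y + supp C (- u) <= 2 * supp (CMAX C) u.
Proof.
move=> n2 bC h0; have [C0 cC _] := bC; have bM := convex_body_CMAX bC.
have [M0 cM _] := bM; rewrite /supercompletion DMAX_self //.
split=> [Sy u|Sy x Cx].
  rewrite -lerBrDl; apply: supp_le => // x /Sy[_ [z Mz <-] <-].
  have := supp_ubound u cM Mz; rewrite dotpNl dotpDr dotpZr; lra.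
exists (y - x); last by rewrite subrKC.
exists (2^-1 *: (y - x)); last by rewrite scalerA mulfV ?scale1r.
apply: convex_body_supp => // u; rewrite dotpZr ler_pdivrMl //.
by apply: le_trans (Sy u); rewrite dotpDr lerD2l dotpNr -dotpNl supp_ubound.
Qed.

Lemma CMAX_sub_supercompletion C : (2 <= n)%N -> convex_body C -> C° 0 ->
  CMAX C `<=` supercompletion C.
Proof.
move=> n2 bC h0 y My; apply/supercompletionP => // u.
have [_ cM _] := convex_body_CMAX bC.
rewrite mulr_natl mulr2n lerD ?supp_ubound //.
by rewrite supp_CMAX // le_max lexx orbT.
Qed.

(** With [h] and [g] the support functions of [C] and [CMAX C], the claim is
[2 g(u) - h(-u) <= s h(u)]. If [h(u) <= h(-u)] this is [h(-u) <= s h(u)], which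
is Minkowski-centeredness; otherwise
[h(u) - h(-u) <= (s - 1) h(-u) <= (s - 1) h(u)]. *)
Lemma supercompletion_sub_scale C : (2 <= n)%N -> convex_body C -> C° 0 ->
  Minkowski_centered C ->
  supercompletion C `<=` translate 0 (scale_set (asymmetry C) C).
Proof.
move=> n2 bC h0 mC y /(supercompletionP _ n2 bC h0) Sy.
have s1 := asymmetry_ge1 (ltnW n2) bC h0 mC; set s := asymmetry C in s1 *.
have s0 : 0 < s by apply: lt_le_trans s1.
exists y; last by rewrite add0r.
exists (s^-1 *: y); last by rewrite scalerA mulfV ?scale1r // gt_eqF.
apply: convex_body_supp => // u; rewrite dotpZr ler_pdivrMl //.
have := Sy u.
have := supp_Minkowski u bC mC; have := supp_Minkowski (- u) bC mC.
rewrite opprK supp_CMAX // -/s; set h := supp C u; set h' := supp C (- u).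
case: (leP h h') => [_ h'h _ Sy'|h'h _ hh' Sy']; first by move: h'h Sy'; lra.
have : 0 <= (s - 1) * (h - h') by rewrite mulr_ge0 // subr_ge0 // ltW.
by move: Sy' hh'; lra.
Qed.

(** A completion [K] has width at most [2 g(u)] in the direction [u], and its
support function at [- u] is at least that of [C]. *)
Lemma completion_sub_supercompletion C K : (2 <= n)%N -> convex_body C ->
  C° 0 -> completion C C K -> K `<=` supercompletion C.
Proof.
move=> n2 bC h0 [[[K0 cK _] _] CK KC] y Ky; apply/supercompletionP => // u.
have [C0 _ _] := bC; move: KC; rewrite DMAX_self // => <-.
apply: le_trans (width_DMAX u bC h0 K0 cK).
by rewrite lerD ?supp_ubound // suppS.
Qed.

Lemma supp_boundary_polar C a : convex_body C -> boundary (polar C) a ->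
  supp C a = 1.
Proof.
move=> [C0 cC _] [cla nia]; have cs := continuous_supp C0 cC.
apply/eqP; rewrite eq_le; apply/andP; split.
  have clP : closed (polar C).
    apply: (@preimage_closed _ _ (supp C) [set r : R | r <= 1]).
      by move=> v _; exact: cs.
    exact: closed_le.
  by move: cla; rewrite -(proj1 (closure_id _) clP).
rewrite leNgt; apply/negP => a1; apply: nia.
have oP : open (supp C @^-1` [set r : R | r < 1]).
  by apply: open_comp => // v _; exact: cs.
by apply: filterS (open_nbhs_nbhs (conj oP a1)) => v /ltW.
Qed.

(** Moving [a] outwards along its own ray leaves the polar. *)
Lemma boundary_polar_supp C a : convex_body C -> supp C a = 1 ->
  boundary (polar C) a.
Proof.
move=> [C0 cC _] ha; split.
  by apply: subset_closure; rewrite /polar /= ha.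
move=> /nbhs_ballP[r /= r0 rC]; have k0 : 0 < `|a| + 1 by rewrite ltr_wpDl.
pose e := r / (`|a| + 1); have e0 : 0 < e by exact: divr_gt0.
have : polar C (a + e *: a).
  apply: rC; rewrite -ball_normE /= opprD addNKr normrN normrZ gtr0_norm //.
  by rewrite /e mulrAC ltr_pdivrMr // ltr_pM2l // ltrDl.
rewrite /polar /= -{1}[a]scale1r -scalerDl suppZ // ?ha; last first.
  by rewrite addr_ge0 // ltW.
lra.
Qed.

Lemma nbhs_opp a (B : set 'rV[R]_n) : nbhs (- a) B -> nbhs a [set x | B (- x)].
Proof. exact: (@opp_continuous _ a B). Qed.

Lemma boundary_opp (A : set 'rV[R]_n) a :
  boundary (opp_set A) a <-> boundary A (- a).
Proof.
have -> : opp_set A = [set x | A (- x)].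
  apply/seteqP; split=> [_ [x Ax <-]|x Ax] /=; first by rewrite opprK.
  by exists (- x); rewrite ?opprK.
split=> -[cla nia]; split.
- move=> B; move/nbhs_opp/cla => [x [/= Ax Bx]]; by exists (- x).
- by move=> /nbhs_opp.
- move=> B aB; have /cla[x [Ax Bx]] : nbhs (- a) [set x | B (- x)].
    by apply: nbhs_opp; rewrite opprK.
  by exists (- x); rewrite /= opprK.
- move=> aA; apply: nia; rewrite /interior.
  have -> : A = [set x | [set x | A (- x)] (- x)].
    by apply/funext => x /=; rewrite opprK.
  by apply: nbhs_opp; rewrite opprK.
Qed.

(** The support function [h] of [C] is the gauge of the polar, so the normals of
the outer symmetric support are the [a] with [h(a) = h(-a) = 1]. *)
Lemma outer_symmetric_supportP C y : convex_body C ->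
  outer_symmetric_support C y <->
  forall a, supp C a = 1 -> supp C (- a) = 1 -> dotp a y <= 1.
Proof.
move=> bC; split=> Oy a.
  move=> ha hNa; apply: Oy; split; first exact: boundary_polar_supp.
  by apply/boundary_opp; exact: boundary_polar_supp.
move=> [/(supp_boundary_polar bC) ha /boundary_opp/(supp_boundary_polar bC)].
exact: Oy.
Qed.

End Supercompletion.
(** * Equality with the outer symmetric support *)

Section Equality.
Context {R : realType} {n : nat}.
Implicit Types (C K : set 'rV[R]_n) (a u v w x y z : 'rV[R]_n).

(** A positive [1]-homogeneous continuous function attains a positive minimum on
the unit sphere. *)
Lemma homogeneous_lower_bound (f : 'rV[R]_n -> R) : continuous f ->
  (forall c u, 0 <= c -> f (c *: u) = c * f u) ->
  (forall u, u != 0 -> 0 < f u) ->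
  exists2 m : R, 0 < m & forall u, m * `|u| <= f u.
Proof.
move=> cf hf f0; pose S := [set u : 'rV[R]_n | `|u| = 1].
have cS : compact S.
  apply: bounded_closed_compact.
    by exists 1; split => // x x1 u /= ->; exact: ltW.
  apply: (@preimage_closed _ _ (fun u : 'rV[R]_n => `|u|) [set 1 : R]).
    by move=> u _; exact: norm_continuous.
  exact: closed_eq.
have SN u : u != 0 -> S (`|u|^-1 *: u).
  by move=> u0; rewrite /S /= normrZ normfV normr_id mulVf ?normr_eq0.
have f00 : f 0 = 0 by rewrite -(scale0r 0) hf // mul0r.
have [S0|/set0P/negP/negPn/eqP S0] := pselect (S !=set0); last first.
  exists 1 => // u; have [->|/SN] := eqVneq u 0; last by rewrite S0.
  by rewrite normr0 mulr0 f00.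
have [v] := compact_EVT_min S0 cS (continuous_subspaceT cf).
rewrite inE => Sv vmin; exists (f v) => [|u].
  by apply: f0; rewrite -normr_eq0 Sv oner_eq0.
have [->|u0] := eqVneq u 0; first by rewrite normr0 mulr0 f00.
have un : 0 < `|u| by rewrite normr_gt0.
have /vmin : `|u|^-1 *: u \in S by rewrite inE; exact: SN.
by rewrite hf ?invr_ge0 // mulrC ler_pdivlMr.
Qed.

(** The slack in the inequalities defining the supercompletion is positive and
[1]-homogeneous in [u], so it dominates a multiple of [|u|], which pays for a
small dilation of [z]. *)
Lemma scale_supercompletion C z : (2 <= n)%N -> convex_body C -> C° 0 ->
  (forall u, u != 0 -> dotp u z + supp C (- u) < 2 * supp (CMAX C) u) ->
  exists2 e : R, 0 < e & supercompletion C ((1 + e) *: z).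
Proof.
move=> n2 bC h0 hz; have [C0 cC _] := bC; have [M0 cM _] := convex_body_CMAX bC.
pose f u := 2 * supp (CMAX C) u - (dotp u z + supp C (- u)).
have cf : continuous f.
  have cs := continuous_supp C0 cC; have cg := continuous_supp M0 cM.
  move=> u; apply: (@continuousB _ R^o _ (cst 2 \* supp (CMAX C))
    ((fun u => dotp u z) + (supp C \o -%R))).
    by apply: continuousM; [exact: cst_continuous|exact: cg].
  apply: (@continuousD _ R^o).
    apply: (@continuous_dotp _ _ _ id (cst z)) => v; last exact: cst_continuous.
    exact: cvg_id.
  by apply: continuous_comp; [exact: opp_continuous|exact: cs].
have [c u c0|u u0|m m0 fm] := homogeneous_lower_bound cf.
- by rewrite /f -scalerN !suppZ // dotpZl; ring.
- by rewrite /f subr_gt0 hz.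
pose N := n%:R * `|z| + 1; have N0 : 0 < N by rewrite ltr_wpDl // mulr_ge0.
exists (m / N) => [|]; first exact: divr_gt0.
apply/supercompletionP => // u; rewrite dotpZr mulrDl mul1r.
suff : m / N * dotp u z <= f u by rewrite /f; lra.
apply: le_trans (fm u); rewrite mulrAC ler_pdivrMr // -mulrA ler_pM2l //.
apply: le_trans (ler_norm _) _; apply: le_trans (ler_norm_dotp _ _) _.
by rewrite mulrAC mulrC ler_wpM2l // lerDl.
Qed.

Lemma segment_balanced C u v : convex_body C ->
  supp C (- u) <= supp C u -> supp C v <= supp C (- v) ->
  exists2 t : R, 0 <= t <= 1 &
    supp C (t *: u + (1 - t) *: v) = supp C (- (t *: u + (1 - t) *: v)).
Proof.
move=> bC hu hv; pose f w := supp C w - supp C (- w).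
pose p (t : R) := t *: u + (1 - t) *: v.
have cp : continuous (f \o p).
  move=> t; apply: continuous_comp; last exact: continuous_skew.
  apply: cvgD; apply: cvgZr_tmp; first exact: cvg_id.
  by apply: cvgB; [exact: cvg_cst|exact: cvg_id].
have [|||t] := @IVT R (f \o p) 0 1 0.
- exact: ler01.
- exact: continuous_subspaceT.
- rewrite /= /p scale0r add0r subr0 !scale1r subrr scale0r addr0.
  by rewrite /f ge_min subr_le0 hv le_max !subr_ge0 hu orbT.
by rewrite in_itv/= => t01 /eqP; rewrite subr_eq0 => /eqP ft; exists t.
Qed.

(** If a nonzero functional [u] violates the strict inequality at [z] in
[CMAX C], it supports [CMAX C] at [z] and [h(u) <= h(-u)]. *)
Lemma tight_or_scale C z : (2 <= n)%N -> convex_body C -> C° 0 -> CMAX C z ->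
  (exists u, [/\ u != 0, supp (CMAX C) u <= dotp u z &
      supp C u <= supp C (- u)]) \/
  (exists2 e : R, 0 < e & supercompletion C ((1 + e) *: z)).
Proof.
move=> n2 bC h0 Mz; have [_ cM _] := convex_body_CMAX bC.
have [[u [u0 hu]]|nu] := pselect (exists u, u != 0 /\
    2 * supp (CMAX C) u <= dotp u z + supp C (- u)).
  left; exists u; have := supp_ubound u cM Mz.
  have : supp C (- u) <= supp (CMAX C) u.
    by rewrite supp_CMAX // le_max lexx orbT.
  have : supp C u <= supp (CMAX C) u by rewrite supp_CMAX // le_max lexx.
  by split => //; lra.
right; apply: scale_supercompletion => // u u0; rewrite ltNge; apply/negP => hu.
by apply: nu; exists u.
Qed.

(** On the segment joining functionals of opposite types that support [CMAX C]
at [z] there is one with equal values of [h] at [w] and [- w]; it supports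
[CMAX C] at [z] too, and scales to a defining functional of the outer symmetric
support. *)
Lemma balanced_support C u v z : convex_body C -> C° 0 -> CMAX C z ->
  u != 0 -> supp (CMAX C) u <= dotp u z -> supp C (- u) <= supp C u ->
  v != 0 -> supp (CMAX C) v <= dotp v z -> supp C v <= supp C (- v) ->
  exists a, [/\ supp C a = 1, supp C (- a) = 1 & 1 <= dotp a z].
Proof.
move=> bC h0 Mz u0 uz hu v0 vz hv; have [C0 cC _] := bC.
have [M0 cM _] := convex_body_CMAX bC.
have [t /andP[t0 t1] hw] := segment_balanced bC hu hv.
have t1' : 0 <= 1 - t by rewrite subr_ge0.
set w := t *: u + _ in hw.
have wz : supp (CMAX C) w <= dotp w z.
  rewrite (le_trans (suppD _ _ M0 cM)) // !suppZ // dotpDl !dotpZl.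
  by rewrite lerD // ler_wpM2l.
have wz0 : 0 < dotp w z.
  have gu := lt_le_trans (supp_CMAX_gt0 bC h0 u0) uz.
  have gv := lt_le_trans (supp_CMAX_gt0 bC h0 v0) vz.
  rewrite dotpDl !dotpZl; move: t0; rewrite le_eqVlt => /predU1P[<-|t_gt0].
    by rewrite mul0r add0r subr0 mul1r.
  by rewrite ltr_pwDl ?mulr_gt0 // mulr_ge0 // ltW.
have w0 : w != 0 by apply: contraTneq wz0 => ->; rewrite dotp0l ltxx.
have hw0 : 0 < supp C w by exact: supp_gt0.
have i0 : 0 <= (supp C w)^-1 by rewrite invr_ge0 ltW.
exists ((supp C w)^-1 *: w).
rewrite -scalerN !suppZ // -hw mulVf ?gt_eqF //; split => //.
rewrite dotpZl ler_pdivlMl // mulr1 (le_trans _ wz) //.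
by rewrite supp_CMAX // le_max lexx.
Qed.

(** Take the last point [z] of [CMAX C] on the ray from [0] to a point [y]
outside [CMAX C]. Neither [z] nor [- z] can be scaled up inside the
supercompletion, so both types of supporting functionals occur at [z], and
[balanced_support] gives a functional excluding [y] from the outer symmetric
support. *)
Lemma outer_sub_CMAX C : (2 <= n)%N -> convex_body C -> C° 0 ->
  supercompletion C `<=` CMAX C -> outer_symmetric_support C `<=` CMAX C.
Proof.
move=> n2 bC h0 SM y /(outer_symmetric_supportP _ bC) Oy.
apply: contrapT => nMy.
have [_ cC vC] := bC; have [_ cM vM] := convex_body_CMAX bC.
have M0 : CMAX C 0 by apply: sub_CMAX; exact: nbhs_singleton h0.
have Mlt (t : R) : CMAX C (t *: y) -> t < 1.
  move=> Mt; rewrite ltNge; apply/negP => t1; apply: nMy.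
  have t0 : 0 < t by apply: lt_le_trans t1.
  have t01 : 0 <= t^-1 <= 1 by rewrite invr_ge0 ltW //= invf_le1.
  move/convex_setP : vM => /(_ _ _ _ t01 Mt M0).
  by rewrite scaler0 addr0 scalerA mulVf ?scale1r // gt_eqF.
pose T := `[0, 1] `&` [set t : R | CMAX C (t *: y)].
have TP t : T t <-> 0 <= t <= 1 /\ CMAX C (t *: y).
  by rewrite /T /setI /= in_itv.
have T0 : T !=set0.
  by exists 0; apply/TP; rewrite lexx ler01 scale0r.
have cT : compact T.
  apply: compact_closedI; first exact: segment_compact.
  apply: (@preimage_closed _ _ (fun t : R => t *: y) (CMAX C)).
    by move=> t _; exact: scalel_continuous.
  by apply: compact_closed cM; exact: norm_hausdorff.
have [l] := compact_EVT_max T0 cT (continuous_subspaceT (fun=> cvg_id)).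
rewrite inE => /TP[/andP[l0 l1] Ml] lmax.
have lmax' (t : R) : 0 <= t -> CMAX C (t *: y) -> t <= l.
  move=> t0 Mt; apply: lmax; rewrite inE; apply/TP; split => //.
  by rewrite t0 ltW // Mlt.
have lgt0 : 0 < l.
  have [e e0 /sub_CMAX Me] := interior_absorbs y h0.
  by apply: (lt_le_trans e0); apply: lmax' Me; exact: ltW.
(* Scaling up [z = l y] would contradict the choice of [l]. *)
have nscale (e : R) : 0 < e -> ~ CMAX C ((1 + e) *: (l *: y)).
  move=> e0; have e1 : 0 <= 1 + e by rewrite addr_ge0 // ltW.
  rewrite scalerA => /(lmax' _ (mulr_ge0 e1 l0)).
  by rewrite leNgt ltr_pMl // ltrDl e0.
have [[v [v0 vz hv]]|[e e0 /SM]] := tight_or_scale n2 bC h0 Ml; last first.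
  exact: nscale.
have [[u [u0 uz hu]]|[e e0 /SM/(CMAX_opp vC)]] :=
    tight_or_scale n2 bC h0 (CMAX_opp vC Ml); last first.
  by rewrite -scalerN opprK; exact: nscale.
have [||||||a [ha hNa]] := @balanced_support C (- u) v (l *: y) bC h0 Ml.
- by rewrite oppr_eq0.
- by rewrite supp_CMAXN // dotpNl -dotpNr.
- by rewrite opprK.
- exact: v0.
- exact: vz.
- exact: hv.
rewrite dotpZr leNgt => /negP; apply; apply: le_lt_trans (Mlt _ Ml).
by rewrite ler_piMr // Oy.
Qed.

End Equality.
(** * Completions *)

Section Completions.
Context {R : realType} {n : nat}.
Implicit Types (C K : set 'rV[R]_n).

(** A proper superset with diameter at most [2] would have support function at
most [2 g(u) - g(-u) = g(u)], where [g] is that of [CMAX C]. *)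
Lemma completion_CMAX C : (2 <= n)%N -> convex_body C -> C° 0 ->
  completion C C (CMAX C).
Proof.
move=> n2 bC h0; have bM := convex_body_CMAX bC; have [M0 cM _] := bM.
rewrite /completion DMAX_self // DMAX_CMAX //; last exact: ltnW.
split => //; last exact: sub_CMAX.
split => // K [K0 cK _] [MK nKM]; rewrite DMAX_CMAX //; last exact: ltnW.
rewrite ltNge; apply/negP => D2; apply: nKM.
apply: convex_body_sub_supp => // u.
have := width_DMAX u bC h0 K0 cK.
have := suppS (- u) M0 cK MK; rewrite supp_CMAXN //.
have := ler_wpM2r (_ : 0 <= supp (CMAX C) u) D2.
have [->|u0] := eqVneq u 0; first by rewrite !supp0.
by move=> /(_ (ltW (supp_CMAX_gt0 bC h0 u0))); lra.
Qed.

(** For symmetric [K] the width in the direction [u] is twice the support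
function, so diameter [2] puts [K] inside [CMAX C]; as [K] is complete, it
cannot be a proper subset of a body of the same diameter. *)
Lemma symmetric_completion_unique C K : (2 <= n)%N -> convex_body C -> C° 0 ->
  completion C C K -> symmetric0 K -> K = CMAX C.
Proof.
move=> n2 bC h0 [[bK Kmax] _ DK] symK; have [K0 cK _] := bK.
have bM := convex_body_CMAX bC; have [M0 cM _] := bM.
have KM : K `<=` CMAX C.
  apply: convex_body_sub_supp => // u.
  have := width_DMAX u bC h0 K0 cK; rewrite DK DMAX_self //.
  have : supp K u <= supp K (- u).
    apply: supp_le => // x Kx; rewrite -(opprK x) dotpNr -dotpNl supp_ubound //.
    by rewrite symK; exists x.
  lra.
apply/seteqP; split => //; apply: contrapT => nMK.
have := Kmax _ bM (conj KM nMK).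
by rewrite DK DMAX_self // DMAX_CMAX ?ltxx // ltnW.
Qed.

Lemma circumradius_completion C K : (2 <= n)%N -> convex_body C -> C° 0 ->
  Minkowski_centered C -> completion C C K -> circumradius K C <= asymmetry C.
Proof.
move=> n2 bC h0 mC cK; apply: (@circumradius_le _ _ _ _ _ 0).
  exact: circumradius_ge0.
move=> x /(completion_sub_supercompletion n2 bC h0 cK).
exact: supercompletion_sub_scale.
Qed.

Lemma circumradius_CMAX C : (2 <= n)%N -> convex_body C -> C° 0 ->
  Minkowski_centered C -> circumradius (CMAX C) C = asymmetry C.
Proof.
move=> n2 bC h0 mC; apply/eqP; rewrite eq_le; apply/andP; split.
  by apply: circumradius_completion => //; exact: completion_CMAX.
apply: lb_le_inf => [|r [r0 [t Mt]]]; last first.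
  exact: asymmetry_le_circumradius_CMAX Mt.
exists (asymmetry C); split; first exact: circumradius_ge0.
exists 0 => x /(CMAX_sub_supercompletion n2 bC h0).
exact: supercompletion_sub_scale.
Qed.

Lemma supercompletion_sub_outer C : (2 <= n)%N -> convex_body C -> C° 0 ->
  supercompletion C `<=` outer_symmetric_support C.
Proof.
move=> n2 bC h0 y /(supercompletionP _ n2 bC h0) Sy.
apply/outer_symmetric_supportP => // a ha hNa.
by have := Sy a; rewrite supp_CMAX // ha hNa maxxx; lra.
Qed.

End Completions.

Theorem lemma4p3 (R : realType) (n : nat) (C : set 'rV[R]_n)
    (hn : (2 <= n)%N) (hC : convex_body C) (hMC : Minkowski_centered C)
    (h0 : C° 0) :
  [/\ [/\ completion C C (CMAX C),
          circumradius (CMAX C) C = asymmetry C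
        & forall K : set 'rV[R]_n, completion C C K ->
            circumradius K C <= circumradius (CMAX C) C],
      CMAX C `<=` supercompletion C /\
        supercompletion C `<=` outer_symmetric_support C,
      CMAX C = supercompletion C <-> CMAX C = outer_symmetric_support C
    & [/\ completion C C (CMAX C), symmetric0 (CMAX C)
        & forall K : set 'rV[R]_n, completion C C K -> symmetric0 K ->
            K = CMAX C]].
Proof.
have cM := completion_CMAX hn hC h0.
have MS := CMAX_sub_supercompletion hn hC h0.
have SO := supercompletion_sub_outer hn hC h0.
split => //.
- split => //; first exact: circumradius_CMAX.
  by move=> K cK; rewrite circumradius_CMAX // circumradius_completion.
- split=> [MSE|MOE]; apply/seteqP; split => //.
  + by move=> y My; apply/SO/MS.
  + by apply: outer_sub_CMAX => //; rewrite -MSE.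
  + by rewrite MOE.
- split => //; first by apply: symmetric0_CMAX; case: hC.
  by move=> K; exact: symmetric_completion_unique.
Qed.
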